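(* Let $k\geq 1$ be an integer and let $s$ be a real number with $0\le s<2-\frac{4}{2k+1}$. There exists a compact set $E\subset\mathbb{R}^2$ with Hausdorff dimension $\dim E=s$ and $\mathcal{L}_{2k-1}(\mathcal{A}_k(E))=0$, where $\mathcal{A}_k(E)$ is the set of area types of $(k+1)$-point configurations in $E$, viewed as a subset of a $(2k-1)$-dimensional flat.
   Context: Throughout, for $v=(v_1,v_2)\in\mathbb{R}^2$ write $v^\perp=(v_2,-v_1)$, so that $u\cdot v^\perp=u_1v_2-u_2v_1$ is the determinant of the matrix with columns $u,v$ (the signed area of the parallelogram spanned by $u,v$). $\dim$ denotes Hausdorff dimension. A $(k+1)$-point configuration is $x=(x^1,\dots,x^{k+1})\in(\mathbb{R}^2)^{k+1}$. Its area type is the vector $(x^i\cdot x^{j\perp})_{1\leq i<j\leq k+1}\in\mathbb{R}^{\binom{k+1}{2}}$. The configuration $x$ is called non-degenerate if $\{x^1,x^2\}$ is linearly independent. For non-degenerate $x$ there is a unique $g\in \mathrm{SL}_2(\mathbb{R})$ with $gx^1=(1,0)$ and $gx^2=(0,x^1\cdot x^{2\perp})$; set $$A(x)=(gx^1,\dots,gx^{k+1})=(1,0,0,x^1\cdot x^{2\perp},gx^3,\dots,gx^{k+1})\in\mathbb{R}^{2k+2}.$$ Two non-degenerate configurations have the same area type if and only if they have the same image under $A$, so the non-degenerate area types are identified with points of the $(2k-1)$-dimensional flat in $\mathbb{R}^{2k+2}$ of points whose first three coordinates are $(1,0,0)$. This flat is equipped with $(2k-1)$-dimensional Lebesgue measure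 $\mathcal{L}_{2k-1}$ (in the last $2k-1$ coordinates). Under this identification, $\mathcal{A}_k(E)$ is the set $\{A(x): x\in E^{k+1},\ x \text{ non-degenerate}\}$ (degenerate configurations are disregarded). *)

(* Defs.v *)
From mathcomp Require Import all_boot all_order all_algebra.
From mathcomp Require Import ring lra zify.
From mathcomp Require Import all_classical all_reals all_analysis.
Set Implicit Arguments.
Unset Strict Implicit.
Unset Printing Implicit Defensive.
Import Order.TTheory GRing.Theory Num.Theory.
Import numFieldNormedType.Exports.
Local Open Scope classical_set_scope.
Local Open Scope ring_scope.

Section HausdorffDimension.
Context {R : realType} {n : nat}.
Implicit Types (x y : 'cV[R]_n) (U E : set 'cV[R]_n).

(* The norm that the library puts on matrices is the sup norm. *)
Definition edist x y : R := Num.sqrt (\sum_i (x i 0 - y i 0) ^+ 2).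

(* 0 is added to the set so that the diameter of the empty set is 0. *)
Definition ediam U : \bar R :=
  ereal_sup (0%E |` [set (edist p.1 p.2)%:E | p in U `*` U]).

(* Covers are indexed by an arbitrary D : set nat, so finite covers need no
   padding by empty sets (whose gauge would be 0 `^ 0 = 1 when s = 0). *)
Definition hausdorff_premeasure (s delta : R) E : \bar R :=
  ereal_inf [set \esum_(i in DU.1) (ediam (DU.2 i) `^ s)%E |
    DU in [set DU : set nat * (nat -> set 'cV[R]_n) |
      (forall i, DU.1 i -> (ediam (DU.2 i) <= delta%:E)%E) /\
      E `<=` \bigcup_(i in DU.1) DU.2 i]].

Definition hausdorff_measure (s : R) E : \bar R :=
  ereal_sup [set hausdorff_premeasure s delta E | delta in [set d | 0 < d]].

Definition hausdorff_dim E : \bar R :=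
  ereal_inf [set s%:E | s in [set s : R | 0 <= s /\ hausdorff_measure s E = 0%E]].

End HausdorffDimension.

Section LebesgueMeasure.
Context {R : realType} {n : nat}.
Implicit Types (a b : 'rV[R]_n) (A : set 'rV[R]_n).

Definition box a b : set 'rV[R]_n :=
  [set x | forall j, a 0 j <= x 0 j <= b 0 j].

Definition box_volume a b : R := \prod_j (b 0 j - a 0 j).

(* n-dimensional Lebesgue (outer) measure: Lebesgue measure is its restriction
   to the Caratheodory-measurable sets, among which are all the sets of outer
   measure 0. *)
Definition lebesgue_vol A : \bar R :=
  ereal_inf [set \esum_(i in Dab.1) (box_volume (Dab.2 i).1 (Dab.2 i).2)%:E |
    Dab in [set Dab : set nat * (nat -> 'rV[R]_n * 'rV[R]_n) |
      (forall i j, (Dab.2 i).1 0 j <= (Dab.2 i).2 0 j) /\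
      A `<=` \bigcup_(i in Dab.1) box (Dab.2 i).1 (Dab.2 i).2]].

End LebesgueMeasure.

Section AreaTypes.
Context {R : realType}.

Definition vec2 (a b : R) : 'cV[R]_2 := \col_i (if i == 0 then a else b).

Definition perp (v : 'cV[R]_2) : 'cV[R]_2 := vec2 (v 1 0) (- v 0 0).

Definition dot (u v : 'cV[R]_2) : R := \sum_i u i 0 * v i 0.

Lemma dot_perpE (u v : 'cV[R]_2) :
  dot u (perp v) = u 0 0 * v 1 0 - u 1 0 * v 0 0.
Proof.
have l0 : lift ord0 ord0 = 1 :> 'I_2 by exact/val_inj.
rewrite /dot !big_ord_recl big_ord0 !mxE /= !l0 addr0 mulrN.
by [].
Qed.

Lemma dot_vec2 (a b : R) (v : 'cV[R]_2) :
  dot (vec2 a b) (perp v) = a * v 1 0 - b * v 0 0.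
Proof. by rewrite dot_perpE !mxE. Qed.

Lemma mulmx2E (g : 'M[R]_2) (u : 'cV[R]_2) (i : 'I_2) :
  (g *m u) i 0 = g i 0 * u 0 0 + g i 1 * u 1 0.
Proof.
have l0 : lift ord0 ord0 = 1 :> 'I_2 by exact/val_inj.
by rewrite mxE !big_ord_recl big_ord0 !l0 addr0.
Qed.

Lemma det2E (g : 'M[R]_2) : \det g = g 0 0 * g 1 1 - g 0 1 * g 1 0.
Proof.
have l0 : lift ord0 ord0 = 1 :> 'I_2 by exact/val_inj.
have l1 : lift (1 : 'I_2) 0 = 0 :> 'I_2 by exact/val_inj.
rewrite (expand_det_row _ ord0) !big_ord_recl big_ord0 /cofactor !det_mx11.
by rewrite !mxE !l0 l1 /= !expr0 expr1; ring.
Qed.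

Lemma dot_perpM (g : 'M[R]_2) (u v : 'cV[R]_2) :
  dot (g *m u) (perp (g *m v)) = \det g * dot u (perp v).
Proof. by rewrite !dot_perpE det2E !mulmx2E; ring. Qed.

Lemma cV2P (u v : 'cV[R]_2) : u 0 0 = v 0 0 -> u 1 0 = v 1 0 -> u = v.
Proof.
move=> h0 h1; apply/matrixP => i j; rewrite (ord1 j).
by case: i => [[|[|//]] hi]; [move: h0|move: h1];
  congr (_ = _); congr (_ _ _); exact: val_inj.
Qed.

Lemma free2E (u v : 'cV[R]_2) : free [:: u; v] -> dot u (perp v) != 0.
Proof.
move=> fr; apply/negP => /eqP; rewrite dot_perpE => d0.
have indep (a b : R) : a *: u + b *: v = 0 -> a = 0 /\ b = 0.
  move=> h; have /freeP := (fr : free (in_tuple [:: u; v])).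
  move=> /(_ (fun i => if i == ord0 then a else b)).
  rewrite !big_ord_recl big_ord0 /= addr0 => /(_ h) H.
  by split; [exact: (H ord0)|exact: (H (lift ord0 ord0))].
have h1 : v 1 0 *: u + (- u 1 0) *: v = 0.
  by apply: cV2P; rewrite !mxE; [move: d0; lra|ring].
have h2 : v 0 0 *: u + (- u 0 0) *: v = 0.
  by apply: cV2P; rewrite !mxE; [ring|move: d0; lra].
have [_ u1] := indep _ _ h1; have [_ u0] := indep _ _ h2.
have : 1 *: u + 0 *: v = 0.
  by apply: cV2P; rewrite !mxE mul1r mul0r addr0; apply/oppr_inj; rewrite oppr0.
by move=> /indep[/eqP]; rewrite oner_eq0.
Qed.

Context {k : nat}.
Implicit Type x : 'I_k.+1 -> 'cV[R]_2.

(* x^1 and x^2 are x 0 and x 1; inord 1 is the index 1 as soon as 1 <= k. *)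
Definition pt1 x := x ord0.
Definition pt2 x := x (inord 1).

Definition nondegenerate x : Prop := free [:: pt1 x; pt2 x].

Definition area_type x (p : {p : 'I_k.+1 * 'I_k.+1 | (p.1 < p.2)%N}) : R :=
  dot (x (val p).1) (perp (x (val p).2)).

Definition normalizes x (g : 'M[R]_2) : Prop :=
  [/\ \det g = 1, g *m pt1 x = vec2 1 0 &
      g *m pt2 x = vec2 0 (dot (pt1 x) (perp (pt2 x)))].

Definition normalizer x : 'M[R]_2 := get [set g | normalizes x g].

(* A(x): coordinate j of R^(2k+2) is coordinate j mod 2 of the point of index
   j div 2 of g x. *)
Lemma normalizes_unique x g h : nondegenerate x ->
  normalizes x g -> normalizes x h -> g = h.
Proof.
move=> /free2E; set u := pt1 x; set v := pt2 x => nz [_ g1 g2] [_ h1 h2].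
have E1 : g *m u = h *m u by rewrite g1 h1.
have E2 : g *m v = h *m v by rewrite g2 h2.
rewrite dot_perpE in nz.
apply/matrixP => i j.
have := congr1 (fun w : 'cV[R]_2 => w i 0) E1.
have := congr1 (fun w : 'cV[R]_2 => w i 0) E2.
rewrite /= !mulmx2E => e2 e1.
have k0 : (g i 0 - h i 0) * (u 0 0 * v 1 0 - u 1 0 * v 0 0) = 0.
  rewrite (_ : _ * _ = v 1 0 * (g i 0 * u 0 0 + g i 1 * u 1 0
     - (h i 0 * u 0 0 + h i 1 * u 1 0))
     - u 1 0 * (g i 0 * v 0 0 + g i 1 * v 1 0
     - (h i 0 * v 0 0 + h i 1 * v 1 0))); last by ring.
  by rewrite e1 e2; ring.
have k1 : (g i 1 - h i 1) * (u 0 0 * v 1 0 - u 1 0 * v 0 0) = 0.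
  rewrite (_ : _ * _ = u 0 0 * (g i 0 * v 0 0 + g i 1 * v 1 0
     - (h i 0 * v 0 0 + h i 1 * v 1 0))
     - v 0 0 * (g i 0 * u 0 0 + g i 1 * u 1 0
     - (h i 0 * u 0 0 + h i 1 * u 1 0))); last by ring.
  by rewrite e1 e2; ring.
move/eqP: k0; rewrite mulf_eq0 (negbTE nz) orbF subr_eq0 => /eqP k0.
move/eqP: k1; rewrite mulf_eq0 (negbTE nz) orbF subr_eq0 => /eqP k1.
by case: j => [[|[|//]] hj]; [move: k0|move: k1];
  congr (_ = _); congr (_ _ _); exact: val_inj.
Qed.

Lemma normalizerP x : nondegenerate x -> normalizes x (normalizer x).
Proof.
move=> /free2E; set u := pt1 x; set v := pt2 x => nz.
apply: (@getPex _ [set g | normalizes x g]).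
have := nz; rewrite dot_perpE => nz'.
pose d := u 0 0 * v 1 0 - u 1 0 * v 0 0.
exists (\matrix_(i, j) (if i == 0 then (if j == 0 then v 1 0 / d else - v 0 0 / d)
                       else (if j == 0 then - u 1 0 else u 0 0))).
rewrite /normalizes/= -/u -/v; split.
- by rewrite det2E !mxE /= /d; field.
- by apply: cV2P; rewrite mulmx2E !mxE /= /d; [field|ring].
- by apply: cV2P; rewrite mulmx2E !mxE /= ?dot_perpE /d; [field|ring].
Qed.

Definition normal_form x : 'rV[R]_(k.*2.+2) :=
  \row_(j < k.*2.+2) (normalizer x *m x (inord j./2)) (inord (odd j)) 0.

Definition area_types (E : set 'cV[R]_2) : set 'rV[R]_(k.*2.+2) :=
  [set normal_form x | x in [set x | (forall i, E (x i)) /\ nondegenerate x]].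

Definition last_coords (v : 'rV[R]_(k.*2.+2)) : 'rV[R]_(k.*2.-1) :=
  \row_(j < k.*2.-1) v 0 (inord (3 + j)).

Definition flat : set 'rV[R]_(k.*2.+2) :=
  [set v | [/\ v 0 (inord 0) = 1, v 0 (inord 1) = 0 & v 0 (inord 2) = 0]].

Lemma normal_formE x (i : 'I_k.+1) (c : 'I_2) :
  normal_form x 0 (inord (i.*2 + c)) = (normalizer x *m x i) c 0.
Proof.
have lt : (i.*2 + c < k.*2.+2)%N by have := ltn_ord i; have := ltn_ord c; lia.
rewrite [LHS]mxE inordK//.
have -> : (i.*2 + c)./2 = i by case: c {lt} => [[|[|//]] ?] /=; lia.
have -> : odd (i.*2 + c) = c :> nat.
  by rewrite oddD odd_double; case: c {lt} => [[|[|//]] ?].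
by rewrite !inord_val.
Qed.

Lemma normal_form_flat x : (1 <= k)%N -> nondegenerate x -> flat (normal_form x).
Proof.
move=> k1 /normalizerP[_ g1 g2].
have e0 c := normal_formE x ord0 c; have e1 c := normal_formE x (inord 1) c.
rewrite /flat /=; split.
- transitivity (normal_form x 0 (inord ((@ord0 k).*2 + (0%R : 'I_2)))) => //.
  by rewrite e0 -/(pt1 x) g1 mxE.
- transitivity (normal_form x 0 (inord ((@ord0 k).*2 + (1%R : 'I_2)))) => //.
  by rewrite e0 -/(pt1 x) g1 mxE.
- transitivity (normal_form x 0 (inord ((inord 1 : 'I_k.+1).*2 + (0%R : 'I_2)))).
    by rewrite inordK.
  by rewrite e1 -/(pt2 x) g2 mxE.
Qed.

Lemma normal_formP x y : (1 <= k)%N -> nondegenerate x -> nondegenerate y ->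
  normal_form x = normal_form y <-> area_type x = area_type y.
Proof.
move=> k1 nx ny.
have [dx x1 x2] := normalizerP nx; have [dy y1 y2] := normalizerP ny.
set g := normalizer x in dx x1 x2 *; set h := normalizer y in dy y1 y2 *.
have inv (i j : 'I_k.+1) : dot (g *m x i) (perp (g *m x j)) = dot (x i) (perp (x j)).
  by rewrite dot_perpM dx mul1r.
have invy (i j : 'I_k.+1) : dot (h *m y i) (perp (h *m y j)) = dot (y i) (perp (y j)).
  by rewrite dot_perpM dy mul1r.
split=> [e|e].
  have gh i : g *m x i = h *m y i.
    by apply: cV2P; rewrite -!normal_formE e.
  by apply/funext => p; rewrite /area_type -inv -invy !gh.
have aE (i j : 'I_k.+1) : dot (x i) (perp (x j)) = dot (y i) (perp (y j)).
  have lt_ (a b : 'I_k.+1) : (a < b)%N ->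
      dot (x a) (perp (x b)) = dot (y a) (perp (y b)).
    move=> ab.
    exact: (congr1 (fun f => f (exist (fun p : 'I_k.+1 * 'I_k.+1 => (p.1 < p.2)%N : Prop) (a, b) ab)) e).
  have := lt_ i j; have := lt_ j i; rewrite !dot_perpE.
  case: (ltngtP i j) => [_ _ /(_ isT)//|_ /(_ isT) h0 _|/val_inj -> _ _]; last by ring.
  by move: h0; lra.
have gh i : g *m x i = h *m y i.
  have nz := free2E nx; have dd : dot (pt1 x) (perp (pt2 x)) = _ := aE _ _.
  rewrite -/(pt1 y) -/(pt2 y) in dd.
  have A := aE (inord 1) i; have B := aE ord0 i.
  rewrite -inv -invy -/(pt2 x) -/(pt2 y) x2 y2 -dd in A.
  rewrite -inv -invy -/(pt1 x) -/(pt1 y) x1 y1 in B.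
  move: (dot _ _) nz A B => d nz.
  rewrite !dot_vec2 => A B.
  apply: cV2P; last by move: B; lra.
  by apply: (mulfI nz); move: A; lra.
apply/rowP => j; rewrite !mxE.
by have := congr1 (fun w : 'cV[R]_2 => w (inord (odd j)) 0) (gh (inord j./2)); rewrite /= !mxE.
Qed.

(* Lebesgue measure of dimension 2k-1 on the flat, on which last_coords is
   injective. *)
Definition flat_vol (S : set 'rV[R]_(k.*2.+2)) : \bar R :=
  lebesgue_vol (last_coords @` (S `&` flat)).

End AreaTypes.

Arguments area_types {R} k E.

(* Main.v *)
(* The area of the pair (u y, y), (u' y', y') is y y' (u - u'). Writing the
   points x^i as (u_i y_i, y_i), the area type of a (k+1)-point configuration
   depends only on the k+1 heights y_i and on the k differences u_i - u_1:
   shears preserve areas and save one of the 2k+2 parameters. E is the set of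
   all (u y, y) with u and y in a Cantor set C in [1, 2] that is covered, for
   infinitely many q, by the intervals of length about q^(-2/s) with left
   endpoint in (1/q)Z. At scale q, configurations of E thus have O(q^(2k+1))
   area types up to errors O(q^(-2/s)), hence A_k(E) has (2k-1)-dimensional
   measure at most O(q^(2k+1) q^(-2(2k-1)/s)), which tends to 0 because s < 2 -
   4/(2k+1). The same covers give dim E <= s. When the scales q grow fast
   enough, C contains the image of a map f on [1, 2) whose inverse is Hoelder
   of every exponent smaller than s/2; a cover of E then yields a cover of [1,
   2)^2 by squares, whence dim E >= s. *)
Require Import Defs.
From mathcomp Require Import all_boot all_order all_algebra.
From mathcomp Require Import ring lra zify.
From mathcomp Require Import all_classical all_reals all_analysis.
Import Order.TTheory GRing.Theory Num.Theory.
Import numFieldNormedType.Exports.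
(* MathComp-Analysis also exports an edist. *)
Import Defs.
Local Open Scope classical_set_scope.
Local Open Scope ring_scope.

(** * Measure bounds by finite classification, and countable unions of null sets *)

Section CoveringByClasses.
Context {R : realType}.
Set Implicit Arguments.
Unset Strict Implicit.

Lemma esum_II_le (N : nat) (c : R) (F : nat -> \bar R) :
  (forall i, (i < N)%N -> (0 <= F i <= c%:E)%E) ->
  (\esum_(i in `I_N) F i <= (N%:R * c)%:E)%E.
Proof.
move=> Fc; rewrite esum_fset; last 2 first.
- exact: finite_II.
- by move=> i; rewrite inE /= => /Fc/andP[].
rewrite -fsbig_ord.
apply: (@le_trans _ _ (\sum_(i < N) c%:E)%E).
  by apply: lee_sum => i _; have /andP[] := Fc i (ltn_ord i).
by rewrite sumEFin sumr_const card_ord mulr_natl.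
Qed.

Lemma poweR_le_powR (x : \bar R) (r s : R) :
  0 <= s -> 0 <= r -> (0 <= x <= r%:E)%E -> (x `^ s <= (r `^ s)%:E)%E.
Proof.
move=> s0 r0 /andP[x0 xr]; rewrite -poweR_EFin; apply: gt0_ler_poweR => //.
  by rewrite in_itv/= x0 leey.
by rewrite in_itv/= lee_fin r0 leey.
Qed.

Lemma edist_ge0 (n : nat) (x y : 'cV[R]_n) : 0 <= edist x y.
Proof. exact: sqrtr_ge0. Qed.

Lemma ediam_ge0 (n : nat) (U : set 'cV[R]_n) : (0 <= ediam U)%E.
Proof. by apply: ereal_sup_ubound; left. Qed.

Lemma ediam_le (n : nat) (U : set 'cV[R]_n) (r : R) : 0 <= r ->
  (forall x y, U x -> U y -> edist x y <= r) -> (ediam U <= r%:E)%E.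
Proof.
move=> r0 Ur; apply: ge_ereal_sup => _ [->|[[x y] [/= Ux Uy]] <-].
  by rewrite lee_fin.
by rewrite lee_fin Ur.
Qed.

Lemma edist_le_ediam (n : nat) (U : set 'cV[R]_n) x y : U x -> U y ->
  ((edist x y)%:E <= ediam U)%E.
Proof. by move=> Ux Uy; apply: ereal_sup_ubound; right; exists (x, y). Qed.

Lemma hausdorff_premeasure_ge0 (n : nat) (s d : R) (E : set 'cV[R]_n) :
  (0 <= hausdorff_premeasure s d E)%E.
Proof.
apply: le_ereal_inf_tmp => _ [DU _ <-]; apply: esum_ge0 => i _.
exact: poweR_ge0.
Qed.

Lemma hausdorff_measure_ge0 (n : nat) (s : R) (E : set 'cV[R]_n) :
  (0 <= hausdorff_measure s E)%E.
Proof.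
apply: le_trans (hausdorff_premeasure_ge0 s 1 E) _.
by apply: ereal_sup_ubound; exists 1 => //=.
Qed.

(** The covering sets are the images of the fibres of [h], numbered by [enum_rank]. Upper bounds for
    a measure thus reduce to counting the labels of a classification. *)
Lemma hausdorff_premeasure_classes (n : nat) (X : Type) (T : finType)
    (S : set X) (h : X -> T) (F : X -> 'cV[R]_n) (s d r : R) :
  0 <= s -> 0 <= r <= d ->
  (forall x y, S x -> S y -> h x = h y -> edist (F x) (F y) <= r) ->
  (hausdorff_premeasure s d (F @` S) <= (#|T|%:R * r `^ s)%:E)%E.
Proof.
move=> s0 /andP[r0 rd] Fr.
pose U (i : nat) :=
  [set F x | x in [set x | S x /\ enum_rank (h x) = i :> nat]].
have diamU i : (ediam (U i) <= r%:E)%E.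
  apply: ediam_le => // _ _ [x [Sx hx] <-] [y [Sy hy] <-].
  by apply: Fr => //; apply/enum_rank_inj/val_inj; rewrite /= hx hy.
apply: (@le_trans _ _ (\esum_(i in `I_#|T|) (ediam (U i) `^ s)%E)).
  apply: ereal_inf_lbound; exists (`I_#|T|, U) => //; split => /=.
    by move=> i _; apply: (le_trans (diamU i)); rewrite lee_fin.
  move=> _ [x Sx <-]; exists (enum_rank (h x) : nat) => //=.
  by exists x.
apply: esum_II_le => i _; rewrite poweR_ge0/=.
by apply: poweR_le_powR => //; rewrite ediam_ge0 diamU.
Qed.

Lemma box_volume_ge0 (n : nat) (a b : 'rV[R]_n) :
  (forall j, a 0 j <= b 0 j) -> 0 <= box_volume a b.
Proof. by move=> ab; apply: prodr_ge0 => j _; rewrite subr_ge0. Qed.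

Lemma lebesgue_vol_ge0 (n : nat) (A : set 'rV[R]_n) : (0 <= lebesgue_vol A)%E.
Proof.
apply: le_ereal_inf_tmp => _ [Dab [ab _] <-]; apply: esum_ge0 => i _.
by rewrite lee_fin box_volume_ge0.
Qed.

Lemma lebesgue_vol_classes (n : nat) (X : Type) (T : finType)
    (S : set X) (h : X -> T) (F : X -> 'rV[R]_n) (r : R) : 0 <= r ->
  (forall x y, S x -> S y -> h x = h y ->
    forall j, `|F x 0 j - F y 0 j| <= r) ->
  (lebesgue_vol (F @` S) <= (#|T|%:R * (2 * r) ^+ n)%:E)%E.
Proof.
move=> r0 Fr.
(* Each cube is centred at the image of one member of its class. An empty class gets the centre 0,
   which only wastes a cube. *)
pose c (i : nat) : 'rV[R]_n :=
  xget 0 [set F x | x in [set x | S x /\ enum_rank (h x) = i :> nat]].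
pose ab i := (c i - const_mx r, c i + const_mx r).
have wab i j : (ab i).1 0 j <= (ab i).2 0 j by rewrite !mxE; lra.
apply: (@le_trans _ _
    (\esum_(i in `I_#|T|) (box_volume (ab i).1 (ab i).2)%:E)).
  apply: ereal_inf_lbound; exists (`I_#|T|, ab) => //; split => //=.
  move=> _ [x Sx <-]; exists (enum_rank (h x) : nat) => //= j.
  rewrite /c; case: xgetP => [_ -> [y [Sy hy] <-]|/(_ (F x))[]]; last first.
    by exists x.
  have hyx : h x = h y by apply/enum_rank_inj/val_inj; rewrite /= hy.
  by have := Fr _ _ Sx Sy hyx j; rewrite ler_distl !mxE.
apply: esum_II_le => i _.
rewrite !lee_fin box_volume_ge0 ?andTb; last exact: wab.
rewrite /box_volume (eq_bigr (fun=> 2 * r)).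
  by rewrite prodr_const card_ord.
by move=> j _; rewrite !mxE; ring.
Qed.

(** The i-th set is covered with total volume at most e / 2^(i+1), and the covers are merged into
    one by numbering the pairs (set, box). *)
Lemma lebesgue_vol_bigcup0 (n : nat) (A : nat -> set 'rV[R]_n) :
  (forall i, lebesgue_vol (A i) = 0%E) -> lebesgue_vol (\bigcup_i A i) = 0%E.
Proof.
move=> A0; apply/eqP; rewrite eq_le lebesgue_vol_ge0 andbT.
apply/lee_addgt0Pr => e e0; rewrite add0e.
have e2 i : 0 < e / (2 ^ i.+1)%:R by rewrite divr_gt0// ltr0n expn_gt0.
have /choice[Dab HDab] i : exists Dab : set nat * (nat -> 'rV[R]_n * 'rV[R]_n),
    [/\ (forall l j, (Dab.2 l).1 0 j <= (Dab.2 l).2 0 j),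
        A i `<=` \bigcup_(l in Dab.1) box (Dab.2 l).1 (Dab.2 l).2 &
        (\esum_(l in Dab.1) (box_volume (Dab.2 l).1 (Dab.2 l).2)%:E
          <= (e / (2 ^ i.+1)%:R)%:E)%E].
  have Afin : lebesgue_vol (A i) \is a fin_num by rewrite A0.
  have [_ [Dab [h1 h2] <-] /ltW] := lb_ereal_inf_adherent (e2 i) Afin.
  rewrite -/(lebesgue_vol (A i)) A0 add0e => h3.
  by exists Dab; split.
pose v (k : nat * nat) := (Dab k.1).2 k.2.
pose D := [set: nat] `*`` (fun i => (Dab i).1).
(* A number that encodes no pair gets the degenerate box (0, 0): every index must carry a valid box,
   even outside the index set of the cover. *)
pose w (j : nat) := if unpickle j is Some k then v k else (0, 0).
have wv k : w (pickle k) = v k by rewrite /w pickleK.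
apply: (@le_trans _ _
    (\esum_(j in pickle @` D) (box_volume (w j).1 (w j).2)%:E)).
  apply: ereal_inf_lbound; exists (pickle @` D, w) => //; split => /=.
    move=> i j; rewrite /w; case: unpickle => [k|//=].
    by case: (HDab k.1) => wab _ _; exact: wab.
  move=> x [i _ Aix]; have [_ /(_ x Aix)[l Dl xl] _] := HDab i.
  by exists (pickle (i, l)); [exists (i, l)|rewrite wv].
rewrite (@reindex_esum _ _ _ D (pickle @` D) pickle); last first.
  by apply: inj_bij => x y _ _; exact: (pcan_inj pickleK).
under eq_esum do rewrite wv.
rewrite -(@esum_esum _ _ _ _ _
  (fun i j => (box_volume (v (i, j)).1 (v (i, j)).2)%:E)); last first.
  move=> i j _ _; rewrite lee_fin box_volume_ge0//.
  by case: (HDab i) => wab _ _; exact: wab.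
apply: (@le_trans _ _ (\esum_(i in [set: nat]) (e / (2 ^ i.+1)%:R)%:E)).
  by apply: le_esum => i _; case: (HDab i).
rewrite -nneseries_esumT; last by move=> i; rewrite lee_fin ltW.
have := @epsilon_trick0 R e xpredT (ltW e0).
by [].
Qed.

End CoveringByClasses.

(** * A Cantor set with prescribed scales and its parametrization by binary digits *)

Section CantorSet.
Context {R : realType} (s : R).
Set Implicit Arguments.
Unset Strict Implicit.

(* C is described at stage n by the pair of scales
     2^-(mesh n)      the spacing 1/q of the left endpoints,
     2^-(depth n.+1)  the length of the intervals, about q^(-2/s);
   the binary digits at the positions in (mesh n, depth n.+1] vanish and those
   at the positions in (depth n, mesh n] are free.  [bits n] counts the free
   positions up to [depth n].  The factor n.+1 in [mesh] makes the free digits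
   prevail. *)
Fixpoint depth (n : nat) : nat :=
  if n is m.+1 then (Num.truncn (2 * ((m.+1 * depth m).+1)%:R / s)).+1 else 0.

Definition mesh (n : nat) : nat := (n.+1 * depth n).+1.

Fixpoint bits (n : nat) : nat :=
  if n is m.+1 then bits m + (mesh m - depth m) else 0.

(** Stopping at index 2q, where q = 2^(mesh n), loses no interval that meets [1, 2] and leaves a
    finite, hence closed, union. *)
Definition cantor_level (n : nat) : set R :=
  \bigcup_(a in `I_(2 ^ (mesh n).+1).+1)
    `[a%:R / 2 ^+ mesh n, a%:R / 2 ^+ mesh n + 2 ^- depth n.+1]%classic.

Definition cantor : set R := `[1, 2]%classic `&` \bigcap_n cantor_level n.

Lemma cantor_compact : compact cantor.
Proof.
apply: (subclosed_compact _ (@segment_compact R 1 2)); last by move=> x [].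
apply: closedI; first exact: interval_closed.
apply: closed_bigI => n _; apply: closed_bigcup; first exact: finite_II.
by move=> a _; exact: interval_closed.
Qed.

Lemma depth_lt_mesh n : (depth n < mesh n)%N.
Proof. by rewrite /mesh ltnS leq_pmull. Qed.

(* [embed] distributes the binary digits of [x] over the free positions:
   [digit x n] is the block of digits of [x] that goes to (depth n, mesh n]. *)
Definition code (x : R) (n : nat) : nat := Num.truncn (x * 2 ^+ bits n).

Definition digit (x : R) (n : nat) : nat :=
  code x n.+1 %% 2 ^ (mesh n - depth n).

Fixpoint approx (x : R) (n : nat) : R :=
  if n is m.+1 then approx x m + (digit x m)%:R / 2 ^+ mesh m else 1.

Definition embed (x : R) : R := sup (range (approx x)).

Lemma approx_nondecreasing x : nondecreasing_seq (approx x).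
Proof.
apply/nondecreasing_seqP => n /=.
by rewrite lerDl divr_ge0// exprn_ge0.
Qed.

Lemma ler_digit1 x n : (digit x n)%:R + 1 <= 2 ^+ (mesh n - depth n) :> R.
Proof.
by rewrite natr1 -natrX ler_nat ltn_pmod// expn_gt0.
Qed.

(** With e = [mesh n - depth n] and y = x 2^(bits n), this is floor y = floor (floor (2^e y) /
    2^e). *)
Lemma code_divn x n : 0 <= x ->
  code x n = (code x n.+1 %/ 2 ^ (mesh n - depth n))%N.
Proof.
move=> x0; rewrite /code /= exprD mulrA.
set y := x * _; set e := (mesh n - depth n)%N.
have y0 : 0 <= y by rewrite mulr_ge0// exprn_ge0.
have e0 : (0 : R) < 2 ^+ e by rewrite exprn_gt0.
have /truncn_itv/andP[] : 0 <= y * 2 ^+ e by rewrite mulr_ge0// ltW.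
set T := Num.truncn (y * _) => Ty yT.
apply: truncn_def; apply/andP; split.
  rewrite -(ler_pM2r e0) (le_trans _ Ty)// -natrX -natrM ler_nat.
  exact: leq_trunc_div.
rewrite -(ltr_pM2r e0) (lt_le_trans yT)// -natrX -natrM ler_nat.
by rewrite ltn_ceil// expn_gt0.
Qed.

Lemma code_digit x n : 0 <= x ->
  code x n.+1 = (code x n * 2 ^ (mesh n - depth n) + digit x n)%N.
Proof. by move=> x0; rewrite (code_divn n x0) /digit -divn_eq. Qed.

Lemma eq_approx x y n : (forall j, (j <= n)%N -> code x j = code y j) ->
  approx x n = approx y n.
Proof.
elim: n => //= n IH xy; rewrite IH => [|j jn]; last by rewrite xy// leqW.
by rewrite /digit xy.
Qed.

Hypotheses (s0 : 0 < s) (s2 : s < 2).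

(** With q = 2^(mesh n), this bounds the interval length 2^-(depth n.+1) by q^(-2/s); by [depthS_le]
    it is at least half of that. *)
Lemma depthS_ge n : 2 * (mesh n)%:R <= s * (depth n.+1)%:R.
Proof.
rewrite -ler_pdivrMl// mulrC /=.
by rewrite ltW// truncnS_gt.
Qed.

Lemma depthS_le n : s * (depth n.+1)%:R <= 2 * (mesh n)%:R + s.
Proof.
rewrite /= -natr1 mulrDr mulr1 lerD2r mulrC -ler_pdivlMr//.
by rewrite truncn_le divr_ge0// ltW.
Qed.

(** As s < 2, the exponent 2/s exceeds 1, so the intervals are shorter than their spacing. *)
Lemma mesh_lt_depthS n : (mesh n < depth n.+1)%N.
Proof.
rewrite -(ltr_nat R) -(ltr_pM2l s0); apply: lt_le_trans (depthS_ge n).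
by rewrite ltr_pM2r// ltr0n.
Qed.

Lemma depth_ltS n : (depth n < depth n.+1)%N.
Proof. exact: ltn_trans (depth_lt_mesh n) (mesh_lt_depthS n). Qed.

Lemma leq_depth m n : (m <= n)%N -> (depth m <= depth n)%N.
Proof.
apply: (@homo_leq _ depth leq) => // [? ? ?|i]; first exact: leq_trans.
exact/ltnW/depth_ltS.
Qed.

Lemma ltn_mesh n : (n < mesh n)%N.
Proof.
case: n => [|n]; rewrite /mesh// ltnS; apply: leq_trans (leqnSn _) _.
by rewrite leq_pmulr.
Qed.

(** Hence [approx x n.+1] can serve as a left endpoint in [cantor_level n]. *)
Lemma approx_nat x n : exists a : nat, approx x n.+1 = a%:R / 2 ^+ mesh n.
Proof.
have pow2 m : (2 : R) ^+ m != 0 by rewrite expf_neq0// pnatr_eq0.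
elim: n => [|n [a IH]].
  exists (2 ^ mesh 0 + digit x 0)%N.
  by rewrite /= natrD natrX mulrDl divff.
have le : (mesh n <= mesh n.+1)%N.
  exact: leq_trans (ltnW (mesh_lt_depthS n)) (ltnW (depth_lt_mesh _)).
exists (a * 2 ^ (mesh n.+1 - mesh n) + digit x n.+1)%N.
rewrite [LHS]/= -/(approx x n.+1) IH natrD natrM natrX mulrDl; congr (_ + _).
rewrite -{2}(subnK le) exprD invfM mulrA mulfK//.
Qed.

(** The intervals from [approx x n] to [approx x n] + 2^-(depth n) are nested: the next block of
    digits stays at least one unit 2^-(mesh n) short of 2^-(depth n), and this unit exceeds
    2^-(depth n.+1). *)
Lemma approx_tail x n :
  approx x n.+1 + 2 ^- depth n.+1 <= approx x n + 2 ^- depth n.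
Proof.
rewrite /= -addrA lerD2l.
have p0 m : 0 < (2 : R) ^+ m by rewrite exprn_gt0.
apply: (@le_trans _ _ ((digit x n)%:R / 2 ^+ mesh n + 2 ^- mesh n)).
  rewrite lerD2l lef_pV2 ?posrE//= ler_weXn2l ?ler1n// ltnW//.
  exact: mesh_lt_depthS.
rewrite -[X in _ + X]mul1r -mulrDl ler_pdivrMr//.
rewrite (le_trans (ler_digit1 x n))//.
rewrite -{2}(subnK (ltnW (depth_lt_mesh n))) exprD mulrCA.
by rewrite mulVf ?mulr1 ?gt_eqF.
Qed.

Lemma approx_le x m n : approx x m <= approx x n + 2 ^- depth n.
Proof.
have p0 j : 0 <= (2 : R) ^- j by rewrite invr_ge0 exprn_ge0.
have [mn|/ltnW nm] := leqP m n.
  by rewrite (le_trans (approx_nondecreasing x mn))// lerDl.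
have : nonincreasing_seq (fun i => approx x i + 2 ^- depth i).
  by apply/nonincreasing_seqP => i; exact: approx_tail.
move=> /(_ _ _ nm); apply: le_trans.
by rewrite lerDl.
Qed.

Lemma embed_itv x n : approx x n <= embed x <= approx x n + 2 ^- depth n.
Proof.
apply/andP; split.
  apply: sup_upper_bound; last by exists n.
  split; first by exists (approx x 0), 0.
  by exists (approx x 0 + 2 ^- depth 0) => _ [i _ <-]; exact: approx_le.
apply: sup_le_ub; first by exists (approx x 0), 0.
by move=> _ [i _ <-]; exact: approx_le.
Qed.

Lemma embed_cantor x : cantor (embed x).
Proof.
have := embed_itv x 0; rewrite /= expr0 invr1 => x12.
split; first by rewrite /= in_itv/=.
move=> n _; have [a ax] := approx_nat x n.
have := embed_itv x n.+1; rewrite ax => /andP[ax1 ax2].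
exists a; last by rewrite /= in_itv/= ax1.
rewrite /= ltnS -(ler_nat R) natrX exprS -ler_pdivrMr ?exprn_gt0//.
by rewrite (le_trans ax1)//; case/andP: x12.
Qed.

Lemma leq_bits n : (n <= bits n)%N.
Proof.
elim: n => //= n IH; rewrite -addn1 leq_add// subn_gt0.
exact: depth_lt_mesh.
Qed.

(** With rho = 2 tau / s < 1, tau [depth n.+1] is at most rho [mesh n] + 1, while [bits n.+1] is at
    least [mesh n - depth n]. Since [mesh n] exceeds (n+1) [depth n], the loss [depth n] is at most
    (1 - rho) [mesh n] for large n. *)
Lemma depth_bits_bound (tau : R) : 0 <= tau -> 2 * tau < s ->
  exists K : R, forall n, tau * (depth n)%:R - (bits n)%:R <= K.
Proof.
move=> t0 ts.
pose rho := 2 * tau / s.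
have rho1 : rho < 1 by rewrite ltr_pdivrMr// mul1r.
have t1 : tau <= 1 by move: s2 ts; lra.
(* From [n0] on, n (1 - rho) >= 1; the stages before it cost at most the constant [depth n0]. *)
pose n0 := (Num.truncn (1 - rho)^-1).+1.
have n0rho n : (n0 <= n)%N -> 1 <= n%:R * (1 - rho).
  move=> n0n; rewrite -ler_pdivrMr ?subr_gt0// mul1r.
  by rewrite (le_trans (ltW (truncnS_gt _)))// ler_nat.
exists (1 + (depth n0)%:R) => -[|n].
  by rewrite /= mulr0 subr0 addr_ge0.
have tD : tau * (depth n.+1)%:R <= rho * (mesh n)%:R + 1.
  have := ler_wpM2l (divr_ge0 t0 (ltW s0)) (depthS_le n).
  rewrite mulrDr mulrA divfK ?gt_eqF// => /le_trans; apply; rewrite lerD//.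
  by rewrite /rho mulrCA !mulrA.
have b : (mesh n)%:R - (depth n)%:R <= (bits n.+1)%:R :> R.
  by rewrite -natrB ?ler_nat ?leq_addl// ltnW// depth_lt_mesh.
have [/n0rho h|/ltnW nn0] := leqP n0 n.+1.
  have mD : n.+1%:R * (depth n)%:R <= (mesh n)%:R :> R.
    by rewrite -natrM ler_nat /mesh.
  have : (depth n)%:R <= (1 - rho) * (mesh n)%:R :> R.
    apply: (@le_trans _ _ ((1 - rho) * (n.+1%:R * (depth n)%:R))).
      by rewrite mulrA [_ * n.+1%:R]mulrC ler_peMl.
    by rewrite ler_pM2l// subr_gt0.
  have : 0 <= (depth n0)%:R :> R by [].
  move: tD b; lra.
have : (depth n)%:R <= (depth n0)%:R :> R.
  by rewrite ler_nat leq_depth// ltnW.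
have : rho * (mesh n)%:R <= (mesh n)%:R by rewrite ler_piMl// ltW.
move: tD b; lra.
Qed.

(* At the first stage n.+1 where the codes of x and y differ, by d say,
   |x - y| <= 2 d / 2^(bits n.+1) and |embed x - embed y| >= d / 2^(mesh n + 1);
   as d <= 2^(mesh n - depth n), the claim reduces to [depth_bits_bound]. *)
Lemma embed_holder (tau : R) : 0 <= tau -> 2 * tau < s ->
  exists2 K : R, 0 < K & forall x y, 1 <= x < 2 -> 1 <= y < 2 ->
    `|x - y| <= K * `|embed x - embed y| `^ tau.
Proof.
move=> t0 ts; have [K0 HK] := depth_bits_bound t0 ts.
have t1 : tau <= 1 by move: s2 ts; lra.
(* The factor 2 is that of [xyd] and 2^K0 comes from [depth_bits_bound]; the added 1 pays for the 1
   in [(mesh n).+1], as tau <= 1. *)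
exists (2 * 2 `^ (K0 + 1)) => [|x y /andP[x1 x2] /andP[y1 y2]].
  by rewrite mulr_gt0// powR_gt0.
have p0 m : 0 < (2 : R) ^+ m by rewrite exprn_gt0.
have [->|xy] := eqVneq x y.
  by rewrite subrr normr0 mulr_ge0 ?powR_ge0// mulr_ge0// powR_ge0.
have x0 : 0 <= x by rewrite (le_trans _ x1).
have y0 : 0 <= y by rewrite (le_trans _ y1).
have codeP z n : 0 <= z ->
    (code z n)%:R <= z * 2 ^+ bits n < (code z n)%:R + 1.
  by move=> z0; rewrite natr1 truncn_itv// mulr_ge0// ltW.
have codeB n : `|x - y| * 2 ^+ bits n < `|(code x n)%:R - (code y n)%:R| + 1.
  rewrite -[X in _ * X]gtr0_norm// -normrM mulrBl.
  have /andP[] := codeP _ n x0; have /andP[] := codeP _ n y0.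
  by rewrite real_ltr_norml ?num_real// => *; apply/andP; split;
    case: (ger0P ((code x n)%:R - (code y n)%:R : R)); lra.
have ex_n : exists n, code x n != code y n.
  apply: contrapT => /forallNP eqc.
  have d0 : 0 < `|x - y| by rewrite normr_gt0 subr_eq0.
  pose n := (Num.truncn `|x - y|^-1).+1.
  have /negP/negPn/eqP e := eqc n.
  have := codeB n; rewrite e subrr normr0 add0r; apply/negP; rewrite -leNgt.
  rewrite -ler_pdivrMl// mulr1 (le_trans (ltW (truncnS_gt _)))//.
  rewrite -natrX ler_nat (leq_trans (leq_bits n))//.
  by rewrite ltnW// ltn_expl.
pose n := ex_minn ex_n.
have nP : code x n != code y n by rewrite /n; case: ex_minnP.
have nmin j : (j < n)%N -> code x j = code y j.
  rewrite /n; case: ex_minnP => m _ mmin; rewrite ltnNge => /negP jm.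
  by apply/eqP/negPn/negP => /mmin.
(* At stage 0 both codes are 1, since x and y lie in [1, 2). *)
case: n nP nmin => [|n] nP nmin.
  case/eqP: nP; rewrite /code /= expr0 !mulr1.
  by rewrite (truncn_def (n := 1)) ?x1// (truncn_def (n := 1)) ?y1.
set e := (mesh n - depth n)%N.
pose d : R := `|(digit x n)%:R - (digit y n)%:R|.
have codeE : `|(code x n.+1)%:R - (code y n.+1)%:R| = d.
  by rewrite !code_digit// nmin// !natrD opprD addrACA subrr add0r.
have dne : digit x n != digit y n.
  by apply: contra nP; rewrite !code_digit// nmin// => /eqP ->.
have d1 : 1 <= d.
  rewrite /d; case: (ltngtP (digit x n) (digit y n)) dne => //;
    rewrite -(ler_nat R) -natr1 => lt _;
    by case: (ger0P ((digit x n)%:R - (digit y n)%:R : R)); move: lt; lra.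
have de : d <= 2 ^+ e.
  have := ler_digit1 x n; have := ler_digit1 y n; rewrite -/e.
  have : 0 <= (digit x n)%:R :> R by [].
  have : 0 <= (digit y n)%:R :> R by [].
  by rewrite /d ler_distl => *; apply/andP; split; lra.
have xyd : `|x - y| <= 2 * d / 2 ^+ bits n.+1.
  rewrite ler_pdivlMr// (le_trans (ltW (codeB n.+1)))// codeE; move: d1; lra.
(* The left endpoints are d / 2^(mesh n) apart and the tails have length at most 2^-(mesh n) / 2; as
   d >= 1, at least half of the gap survives. *)
have fd : d / 2 ^+ (mesh n).+1 <= `|embed x - embed y|.
  have := embed_itv x n.+1; have := embed_itv y n.+1.
  rewrite /= (@eq_approx x y n); last by move=> j jn; exact: nmin.
  have : (2 : R) ^- depth n.+1 <= 2 ^- (mesh n).+1.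
    by rewrite lef_pV2 ?posrE// ler_weXn2l ?ler1n// mesh_lt_depthS.
  have mE : (2 : R) ^- (mesh n).+1 = 2 ^- mesh n / 2.
    by rewrite exprSr invfM mulrC.
  rewrite mE.
  set q := 2 ^- mesh n; set dl := 2 ^- _.
  have q0 : 0 <= q by rewrite invr_ge0 ltW.
  have dq : q <= d * q by rewrite ler_peMl.
  rewrite mulrA.
  move: dq; have -> : d * q = `|(digit x n)%:R * q - (digit y n)%:R * q|.
    by rewrite -mulrBl normrM (ger0_norm q0).
  move: (_ * q) (_ * q) (approx y n) (embed x) (embed y) => A B C X Y.
  case: (ger0P (B - A)); case: (ger0P (X - Y)); lra.
have twoX m : (2 : R) ^+ m = 2 `^ m%:R by rewrite powR_mulrn.
have d0 : 0 < d by rewrite (lt_le_trans _ d1).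
apply: (le_trans xyd).
apply: (@le_trans _ _
    (2 * 2 `^ (K0 + 1) * (d / 2 ^+ (mesh n).+1) `^ tau)); last first.
  rewrite ler_pM2l ?mulr_gt0 ?powR_gt0// ge0_ler_powR// ?nnegrE//.
  by rewrite divr_ge0// ltW.
(* Writing d = d^tau d^(1 - tau) cancels d^tau against the right-hand side; with d <= 2^e, a
   comparison of exponents of 2 remains. *)
have -> : 2 * d / 2 ^+ bits n.+1
    = 2 * (d `^ tau * (d `^ (1 - tau) / 2 ^+ bits n.+1)).
  by rewrite [d `^ tau * _]mulrA -powRD ?(gt_eqF d0) ?implybT// addrC subrK
    powRr1 ?mulrA// ltW.
rewrite -mulrA ler_pM2l//.
rewrite powRM ?invr_ge0 ?(ltW d0) ?(ltW (p0 _))//.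
rewrite [leRHS]mulrCA ler_pM2l ?powR_gt0//.
rewrite ler_pdivrMr//.
apply: (@le_trans _ _ ((2 ^+ e) `^ (1 - tau))).
  by rewrite ge0_ler_powR// ?nnegrE ?subr_ge0// ltW.
rewrite !twoX -powRN -!powRrM -!powRD ?pnatr_eq0 ?implybT//.
apply: ler_powR; rewrite ?ler1n//.
have := HK n; rewrite /= natrD -/e -natr1.
have : (mesh n)%:R = e%:R + (depth n)%:R :> R.
  by rewrite -natrD subnK// ltnW// depth_lt_mesh.
move=> ->; move: t1; lra.
Qed.

End CantorSet.

(** * The planar set and its Hausdorff dimension *)

Section ShearedCantorSet.
Context {R : realType}.
Set Implicit Arguments.
Unset Strict Implicit.

Lemma powR2N_small (A e : R) : 0 < e ->
  exists X, forall x, X <= x -> A * 2 `^ (- x) <= e.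
Proof.
move=> e0; have ln2 : 0 < ln (2 : R) by rewrite ln_gt0// ltr1n.
exists (`|A| / e / ln 2) => x; rewrite ler_pdivrMr// ler_pdivrMr// => Ax.
rewrite powRN ler_pdivrMr ?powR_gt0// mulrC.
apply: (le_trans (ler_norm A)); apply: (le_trans Ax); rewrite ler_pM2r//.
rewrite /powR pnatr_eq0/=; apply: le_trans (expR_ge1Dx _).
by rewrite lerDr.
Qed.

Lemma lift0_ord2 : lift ord0 ord0 = 1 :> 'I_2.
Proof. exact/val_inj. Qed.

Lemma edist2E (x y : 'cV[R]_2) :
  edist x y = Num.sqrt ((x 0 0 - y 0 0) ^+ 2 + (x 1 0 - y 1 0) ^+ 2).
Proof. by rewrite /edist !big_ord_recl big_ord0 addr0 !lift0_ord2. Qed.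

Lemma edist_le_l1 (x y : 'cV[R]_2) :
  edist x y <= `|x 0 0 - y 0 0| + `|x 1 0 - y 1 0|.
Proof.
rewrite edist2E -[leRHS]ger0_norm ?addr_ge0// -sqrtr_sqr ler_wsqrtr//.
rewrite [leRHS]sqrrD !real_normK ?num_real// addrAC lerDl.
by rewrite mulrn_wge0// mulr_ge0.
Qed.

Lemma coord_le_edist (x y : 'cV[R]_2) :
  `|x 0 0 - y 0 0| <= edist x y /\ `|x 1 0 - y 1 0| <= edist x y.
Proof.
rewrite edist2E -!sqrtr_sqr; split; apply: ler_wsqrtr.
  by rewrite lerDl sqr_ge0.
by rewrite lerDr sqr_ge0.
Qed.

(** For [p] = (u, y), the image of (0, y) under the shear of matrix [[1, u], [0, 1]]. *)
Definition shear (p : R * R) : 'cV[R]_2 := vec2 (p.1 * p.2) p.2.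

Lemma shear_continuous : continuous shear.
Proof.
move=> p A [B nB sBA].
have shear_ij i j : continuous (fun q => shear q i j).
  rewrite /shear; under eq_fun do rewrite mxE.
  move=> q; case: (i == 0); last exact: cvg_snd.
  by apply: cvgM; [exact: cvg_fst|exact: cvg_snd].
have FF : Filter (nbhs p) := nbhs_filter p.
have nBij i : \forall q \near p, forall j, B i j (shear q i j).
  exact: (@filter_forall _ _ _ _ FF (fun j => shear_ij i j p _ (nB i j))).
by apply: filterS (@filter_forall _ _ _ _ FF nBij) => q Bq; exact: sBA.
Qed.

Lemma shear_dist_le (p q : R * R) (r : R) : 1 <= p.1 <= 2 -> 1 <= p.2 <= 2 ->
  1 <= q.1 <= 2 -> 1 <= q.2 <= 2 ->
  `|p.1 - q.1| <= r -> `|p.2 - q.2| <= r -> edist (shear p) (shear q) <= 5 * r.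
Proof.
case: p q => [u y] [u' y'] /= /andP[? ?] /andP[? ?] /andP[? ?] /andP[? ?] hu hy.
apply: (le_trans (edist_le_l1 _ _)); rewrite !mxE/=.
have -> : u * y - u' * y' = (u - u') * y + u' * (y - y') by ring.
have : `|(u - u') * y + u' * (y - y')| <= r * 2 + 2 * r.
  apply: (le_trans (ler_normD _ _)); rewrite !normrM.
  by apply: lerD; apply: ler_pM => //; rewrite ger0_norm//; lra.
move: hy; lra.
Qed.

(** The difference u - u' is recovered from y (u - u') = (u y - u' y') - u' (y - y') and y >= 1.
    With [shear_dist_le], [shear] is thus bi-Lipschitz on [1, 2]^2. *)
Lemma dist_le_shear (p q : R * R) : 1 <= p.1 <= 2 -> 1 <= p.2 <= 2 ->
  1 <= q.1 <= 2 -> 1 <= q.2 <= 2 ->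
  `|p.1 - q.1| <= 6 * edist (shear p) (shear q) /\
  `|p.2 - q.2| <= 6 * edist (shear p) (shear q).
Proof.
have := coord_le_edist (shear p) (shear q).
case: p q => [u y] [u' y']; rewrite !mxE/=; set D := edist _ _.
move=> [h1 h2] /andP[? ?] /andP[? ?] /andP[? ?] /andP[? ?].
have D0 : 0 <= D by exact: edist_ge0.
split; last by move: h2; lra.
have : y * `|u - u'| <= D + 2 * D.
  rewrite -[y in leLHS]ger0_norm; last by lra.
  rewrite -normrM.
  have -> : y * (u - u') = (u * y - u' * y') - u' * (y - y') by ring.
  apply: (le_trans (ler_normB _ _)); apply: lerD => //; rewrite normrM.
  by apply: ler_pM => //; rewrite ger0_norm//; lra.
have : `|u - u'| <= y * `|u - u'| by rewrite ler_peMl.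
by lra.
Qed.

Variable s : R.

Definition cantor_shear : set 'cV[R]_2 := shear @` (cantor s `*` cantor s).

Lemma cantor_shear_compact : compact cantor_shear.
Proof.
apply: continuous_compact; last by apply: compact_setX; exact: cantor_compact.
by apply: continuous_subspaceT; exact: shear_continuous.
Qed.

(** The default [ord0] is taken only outside the intervals of stage n; [cellP] rules this out on the
    Cantor set. *)
Definition cell (n : nat) (u : R) : 'I_(2 ^ (mesh s n).+1).+1 :=
  xget ord0 [set a : 'I_(2 ^ (mesh s n).+1).+1 |
    a%:R / 2 ^+ mesh s n <= u <= a%:R / 2 ^+ mesh s n + 2 ^- depth s n.+1].

Lemma cellP n u : cantor s u ->
  (cell n u)%:R / 2 ^+ mesh s n <= u
    <= (cell n u)%:R / 2 ^+ mesh s n + 2 ^- depth s n.+1.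
Proof.
move=> [_ /(_ n I)[a /= al]]; rewrite in_itv/= => au; rewrite /cell.
by case: xgetP => [//|/(_ (Ordinal al))].
Qed.

Lemma eq_cell_dist n u v : cantor s u -> cantor s v -> cell n u = cell n v ->
  `|u - v| <= 2 ^- depth s n.+1.
Proof.
move=> /(cellP n) + /(cellP n) + uv; rewrite uv ler_distl.
by move=> /andP[? ?] /andP[? ?]; apply/andP; split; lra.
Qed.

Lemma cantor_itv u : cantor s u -> 1 <= u <= 2.
Proof. by move=> []; rewrite /= in_itv. Qed.

Hypotheses (s0 : 0 < s) (s2 : s < 2).

Lemma card_cell_le n : (2 ^ (mesh s n).+1).+1%:R <= 4 * 2 ^+ mesh s n :> R.
Proof.
rewrite -natr1 natrX exprS.
have : 1 <= (2 : R) ^+ mesh s n by rewrite exprn_ege1// ler1n.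
lra.
Qed.

(** The count common to both measure estimates: q^a pieces of size q^(-2/s), raised to the power b.
    It is used with (a, b) = (2, t) for the dimension and (2k+1, 2k-1) for the area types. *)
Lemma pow2_mesh_depth (a b : R) n : 0 <= b ->
  (2 ^+ mesh s n) `^ a * (2 ^- depth s n.+1) `^ b
    <= 2 `^ (- ((2 * b / s - a) * (mesh s n)%:R)).
Proof.
move=> b0; have twoX m : (2 : R) ^+ m = 2 `^ m%:R by rewrite powR_mulrn.
rewrite !twoX -powRN -!powRrM -powRD ?pnatr_eq0 ?implybT//.
apply: ler_powR; rewrite ?ler1n//.
have := ler_wpM2l (divr_ge0 b0 (ltW s0)) (depthS_ge s0 n).
rewrite [leRHS]mulrA divfK ?gt_eqF// => h.
rewrite mulrBl.
have -> : 2 * b / s * (mesh s n)%:R = b / s * (2 * (mesh s n)%:R).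
  by field; rewrite gt_eqF.
move: h; lra.
Qed.

Lemma hausdorff_measure_cantor_shear0 (t : R) : s < t ->
  hausdorff_measure t cantor_shear = 0%E.
Proof.
move=> st; have t0 : 0 < t by exact: lt_trans st.
apply/eqP; rewrite eq_le hausdorff_measure_ge0 andbT.
apply: ge_ereal_sup => _ [d /= d0 <-].
apply/lee_addgt0Pr => e e0; rewrite add0e.
pose rho := 2 * t / s - 2.
have rho0 : 0 < rho by rewrite subr_gt0 ltr_pdivlMr// ltr_pM2l.
(* [X1] makes the sum small and [X2] the diameters. The 16 is the square of the 4 in [card_cell_le];
   the 5 is that of [shear_dist_le]. *)
have [X1 HX1] := powR2N_small (16 * 5 `^ t) e0.
have [X2 HX2] := powR2N_small 5 d0.
pose n := maxn (Num.truncn (X1 / rho)).+1 (Num.truncn X2).+1.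
have n1 : ((Num.truncn (X1 / rho)).+1 <= n)%N := leq_maxl _ _.
have n2 : ((Num.truncn X2).+1 <= n)%N := leq_maxr _ _.
have nX1 : X1 <= rho * (mesh s n)%:R.
  rewrite mulrC -ler_pdivrMr// (le_trans (ltW (truncnS_gt _)))// ler_nat.
  exact: leq_trans n1 (ltnW (ltn_mesh s n)).
have nX2 : X2 <= (depth s n.+1)%:R.
  rewrite (le_trans (ltW (truncnS_gt _)))// ler_nat.
  apply: leq_trans n2 (leq_trans (ltnW (ltn_mesh s n)) _).
  exact/ltnW/mesh_lt_depthS.
have twoX m : (2 : R) ^+ m = 2 `^ m%:R by rewrite powR_mulrn.
apply: le_trans (@hausdorff_premeasure_classes R 2 _ _ _
  (fun p => (cell n p.1, cell n p.2)) shear t d (5 * 2 ^- depth s n.+1) (ltW t0)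
  _ _) _.
- by rewrite mulr_ge0 ?invr_ge0 ?exprn_ge0//= twoX -powRN HX2.
- move=> p q [p1 p2] [q1 q2].
  move=> [/(eq_cell_dist p1 q1) h1 /(eq_cell_dist p2 q2) h2].
  by apply: shear_dist_le => //; exact: cantor_itv.
rewrite lee_fin card_prod card_ord natrM.
apply: (@le_trans _ _ (4 * 2 ^+ mesh s n * (4 * 2 ^+ mesh s n) *
    (5 * 2 ^- depth s n.+1) `^ t)).
  by rewrite ler_wpM2r ?powR_ge0// ler_pM// card_cell_le.
apply: le_trans (HX1 _ nX1).
rewrite powRM ?invr_ge0 ?exprn_ge0//.
have := @pow2_mesh_depth 2 t n (ltW t0); rewrite powR_mulrn ?exprn_ge0//.
have : 0 <= 5 `^ t by exact: powR_ge0.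
rewrite -/rho => h5 /(ler_wpM2l (mulr_ge0 (ler0n R 16) h5)); apply: le_trans.
by rewrite le_eqVlt; apply/orP; left; apply/eqP; ring.
Qed.

(** A cover of small t-sum is pulled back to [1, 2)^2 along [shear] and [embed]. With Hoelder
    exponent t/2, a set of diameter r pulls back into a square of area c r^t, so the squares would
    cover [1, 2)^2 with total area below 1. *)
Lemma hausdorff_measure_cantor_shear_neq0 (t : R) : 0 <= t < s ->
  hausdorff_measure t cantor_shear != 0%E.
Proof.
move=> /andP[t0 ts]; apply/eqP => H0.
have [||K K0 HK] := @embed_holder R s s0 s2 (t / 2); [lra|lra|].
pose c := 4 * (K ^+ 2 * 6 `^ t).
have c0 : 0 < c by rewrite !mulr_gt0 ?exprn_gt0 ?powR_gt0.
(* The scale 1 only serves to make the diameters in the cover finite. *)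
have P0 : hausdorff_premeasure t 1 cantor_shear = 0%E.
  apply/eqP; rewrite eq_le hausdorff_premeasure_ge0 andbT -H0.
  by apply: ereal_sup_ubound; exists 1 => //=.
have Pfin : hausdorff_premeasure t 1 cantor_shear \is a fin_num by rewrite P0.
have ce0 : 0 < c^-1 / 2 by rewrite divr_gt0// invr_gt0.
have [_ [[D U] /= [U1 UE] <-]] := lb_ereal_inf_adherent ce0 Pfin.
rewrite -/(hausdorff_premeasure _ _ _) P0 add0e => sumU.
pose Q : set (R * R) := `[1, 2[%classic `*` `[1, 2[%classic.
pose W i := Q `&` [set p | U i (shear (embed s p.1, embed s p.2))].
pose r i := fine (ediam (U i)).
have r0 i : 0 <= r i by exact: fine_ge0 (ediam_ge0 _).
have rE i : D i -> ediam (U i) = (r i)%:E.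
  move=> Di; rewrite fineK// ge0_fin_numE ?ediam_ge0//.
  exact: le_lt_trans (U1 i Di) (ltry _).
pose w i := K * (6 * r i) `^ (t / 2).
have w0 i : 0 <= w i by rewrite mulr_ge0 ?powR_ge0// ltW.
have Ww i p q : D i -> W i p -> W i q ->
    `|p.1 - q.1| <= w i /\ `|p.2 - q.2| <= w i.
  move=> Di [[p1 p2] Up] [[q1 q2] Uq].
  have := edist_le_ediam Up Uq; rewrite (rE _ Di) lee_fin => pq.
  move: p1 p2 q1 q2; rewrite /= !in_itv/= => p1 p2 q1 q2.
  have cu x := cantor_itv (embed_cantor s0 s2 x).
  have [h1 h2] := @dist_le_shear (embed s p.1, embed s p.2)
    (embed s q.1, embed s q.2) (cu _) (cu _) (cu _) (cu _).
  split.
    apply: (le_trans (HK _ _ p1 q1)); rewrite ler_pM2l// ge0_ler_powR ?nnegrE//.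
    - by rewrite divr_ge0.
    - by rewrite mulr_ge0.
    - by apply: (le_trans h1); rewrite ler_pM2l.
  apply: (le_trans (HK _ _ p2 q2)); rewrite ler_pM2l// ge0_ler_powR ?nnegrE//.
  - by rewrite divr_ge0.
  - by rewrite mulr_ge0.
  - by apply: (le_trans h2); rewrite ler_pM2l.
pose o i := xget (0, 0) (W i).
pose B i : set (R * R) := `[(o i).1 - w i, (o i).1 + w i]%classic `*`
  `[(o i).2 - w i, (o i).2 + w i]%classic.
have WB i : D i -> W i `<=` B i.
  move=> Di p Wp; have Wo : W i (o i) by apply: xgetPex; exists p.
  by have [] := Ww i p _ Di Wp Wo; rewrite !ler_distl; split;
    rewrite /= in_itv.
pose mu : {measure set _ -> \bar R} :=
  (@lebesgue_measure R \x @lebesgue_measure R)%E.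
have muI (a b : R) :
    a <= b -> lebesgue_measure (`[a, b]%classic : set R) = (b - a)%:E.
  rewrite lebesgue_measure_itv/= lte_fin le_eqVlt => /orP[/eqP ->|->//].
  by rewrite ltxx subrr.
have muX (a b c' d : R) : a <= b -> c' <= d ->
    mu (`[a, b]%classic `*` `[c', d]%classic) = ((b - a) * (d - c'))%:E.
  move=> ab cd; apply: etrans (product_measure1E _ _ _ _) _ => //.
  by rewrite EFinM -(muI a b)// -(muI c' d).
have muB i : mu (B i) = ((2 * w i) ^+ 2)%:E.
  have h x : x - w i <= x + w i by move: (w0 i); lra.
  by apply: etrans (muX _ _ _ _ (h _) (h _)) _; congr _%:E; ring.
have muQ : mu Q = 1%E.
  apply: etrans (product_measure1E _ _ _ _) _ => //.
  have mu12 : lebesgue_measure (`[1, 2[%classic : set R) = 1%E.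
    by rewrite lebesgue_measure_itv/= lte_fin ltr1n/= -EFinB; congr _%:E; ring.
  by rewrite -[RHS]mul1e -mu12.
(* Indices outside [D] get the empty set, so that the series over all of nat is the sum over the
   cover. *)
pose F i := if i \in D then B i else set0.
have QF : Q `<=` \bigcup_i F i.
  move=> p Qp.
  have /UE[i Di Ui] : cantor_shear (shear (embed s p.1, embed s p.2)).
    by exists (embed s p.1, embed s p.2) => //; split; exact: embed_cantor.
  by exists i => //; rewrite /F mem_set//; exact: WB.
have mF i : measurable (F i).
  rewrite /F; case: ifP => // _; apply: measurableX; exact: measurable_itv.
have mQ : measurable Q by apply: measurableX; exact: measurable_itv.
have : (1 <= \sum_(i <oo) mu (F i))%E.
  by rewrite -muQ; exact: measure_sigma_subadditive.
apply/negP; rewrite -ltNge.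
pose g i := (if i \in D then ediam (U i) `^ t else 0)%E.
have g0 i : (0 <= g i)%E by rewrite /g; case: ifP => // _; exact: poweR_ge0.
apply: (@le_lt_trans _ _ (\sum_(i <oo) (c%:E * g i))%E).
  apply: lee_nneseries => [i _ _|i _]; first exact: measure_ge0.
  rewrite /F /g; case: ifPn => [/set_mem Di|_]; last by rewrite measure0 mule0.
  rewrite muB (rE _ Di) poweR_EFin -EFinM lee_fin /w.
  rewrite powRM// !exprMn -!powR_mulrn ?powR_ge0 ?(ltW K0)//.
  rewrite -!powRrM divfK ?(ltW K0)//.
  by rewrite /c !powR_mulrn ?(ltW K0)// -natrX !mulrA.
rewrite nneseriesZl// nneseries_esumT// -esum_mkcond.
apply: (@le_lt_trans _ _ (c%:E * (c^-1 / 2)%:E)%E).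
  by apply: lee_wpmul2l; [rewrite lee_fin ltW|exact: ltW].
by rewrite -EFinM mulrA divff ?gt_eqF// lte_fin mul1r invf_lt1 ?ltr1n.
Qed.

Lemma hausdorff_dim_cantor_shear : hausdorff_dim cantor_shear = s%:E.
Proof.
apply/eqP; rewrite eq_le; apply/andP; split; last first.
  apply: le_ereal_inf_tmp => _ [t [t0 Ht] <-]; rewrite lee_fin leNgt.
  apply/negP => ts; have := @hausdorff_measure_cantor_shear_neq0 t.
  by rewrite t0 ts Ht eqxx => /(_ isT).
apply/lee_addgt0Pr => e e0; apply: ereal_inf_lbound; exists (s + e) => //.
split; first by rewrite addr_ge0// ltW.
by apply: hausdorff_measure_cantor_shear0; rewrite ltrDl.
Qed.

End ShearedCantorSet.

(** * Null measure of the area types *)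

Section AreaTypesOfShears.
Context {R : realType}.
Set Implicit Arguments.
Unset Strict Implicit.

Lemma lebesgue_vol_le (n : nat) (A B : set 'rV[R]_n) : A `<=` B ->
  (lebesgue_vol A <= lebesgue_vol B)%E.
Proof.
move=> AB; apply: le_ereal_inf => _ [Dab [ab BD] <-]; exists Dab => //.
by split=> //; exact: subset_trans BD.
Qed.

(** The bounds 2 and 4 are those of y_1 (u_2 - u_1) and y_i (u_2 - u_i) for parameters in [1, 2]. *)
Lemma dist_ratio_le (n d n' d' a b K : R) : 0 < K -> K <= `|d| -> K <= `|d'| ->
  `|d'| <= 2 -> `|n'| <= 4 -> `|n - n'| <= a -> `|d - d'| <= b ->
  `|n / d - n' / d'| <= (2 * a + 4 * b) / K ^+ 2.
Proof.
move=> K0 Kd Kd' d2 n4 ha hb.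
have nz (x : R) : K <= `|x| -> x != 0.
  by move=> Kx; rewrite -normr_gt0; exact: lt_le_trans Kx.
have -> : n / d - n' / d' = ((n - n') * d' - n' * (d - d')) / (d * d').
  by field; rewrite !nz.
rewrite normrM normfV; apply: ler_pM => //.
  apply: (le_trans (ler_normB _ _)); rewrite !normrM [2 * a]mulrC.
  by apply: lerD; apply: ler_pM.
rewrite lef_pV2 ?posrE ?exprn_gt0//; last by rewrite normr_gt0 mulf_neq0 ?nz.
by rewrite normrM expr2 ler_pM// ltW.
Qed.

Lemma dist_prod_le (x y x' y' a b A B : R) :
  `|x'| <= A -> `|y| <= B -> `|x - x'| <= a -> `|y - y'| <= b ->
  `|x * y - x' * y'| <= a * B + A * b.
Proof.
move=> xA yB xa yb.
have -> : x * y - x' * y' = (x - x') * y + x' * (y - y') by ring.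
apply: (le_trans (ler_normD _ _)); rewrite !normrM.
by apply: lerD; apply: ler_pM.
Qed.

Lemma dot_shear (p q : R * R) :
  dot (shear p) (perp (shear q)) = p.2 * q.2 * (p.1 - q.1).
Proof. by rewrite dot_perpE !mxE /=; ring. Qed.

(** The normalizer g preserves areas, so the areas of g x^i with g x^1 and g x^2, which lie on the
    axes, give its coordinates. *)
Lemma normalizer_coord (k : nat) (x : 'I_k.+1 -> 'cV[R]_2) i :
  nondegenerate x ->
  (normalizer x *m x i) 0 0
    = - dot (pt2 x) (perp (x i)) / dot (pt1 x) (perp (pt2 x)) /\
  (normalizer x *m x i) 1 0 = dot (pt1 x) (perp (x i)).
Proof.
move=> nd; have /free2E d0 := nd; have [dg g1 g2] := normalizerP nd.
split; last first.
  by rewrite -[RHS]mul1r -dg -dot_perpM g1 dot_vec2; ring.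
rewrite -[dot (pt2 x) _]mul1r -{1}dg -dot_perpM g2 dot_vec2 mul0r sub0r opprK.
by rewrite mulrC mulKf.
Qed.

(** By [dot_shear], only heights and differences u_i - u_1 remain: this is the parameter saved by
    shear invariance. The factor y_2 common to the two areas cancels from the quotient. *)
Lemma normalizer_shear (k : nat) (z : 'I_k.+1 -> R * R) i :
  let d j := (z j).1 - (z ord0).1 in
  let y j := (z j).2 in
  y (inord 1) != 0 ->
  nondegenerate (shear \o z) ->
  [/\ d (inord 1) != 0,
    (normalizer (shear \o z) *m shear (z i)) 0 0
      = y i * (d (inord 1) - d i) / (y ord0 * d (inord 1)) &
    (normalizer (shear \o z) *m shear (z i)) 1 0 = - (y ord0 * y i * d i)].
Proof.
move=> d y y1 nd; have := free2E nd.
have [] := normalizer_coord i nd; rewrite /pt1 /pt2 /= => -> ->.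
rewrite !dot_shear -/(y _) -/(y _) => nz.
have d12 : (z ord0).1 - (z (inord 1)).1 = - d (inord 1) by rewrite opprB.
move: nz; rewrite d12 mulrN oppr_eq0 !mulf_eq0 !negb_or.
move=> /andP[/andP[y0 _] d1].
split => //; last by rewrite /d /y; ring.
have -> : (z (inord 1)).1 - (z i).1 = d (inord 1) - d i by rewrite /d; ring.
by rewrite /y in y0 y1 *; field; rewrite d1 y0 y1.
Qed.

Section Shears.
Variables (s : R) (k : nat).
Hypotheses (s0 : 0 < s) (s2 : s < 2).

(** The bound [K] keeps the denominator y_1 (u_2 - u_1) away from 0, which makes the area type
    Lipschitz in the parameters. *)
Definition cantor_params (K : R) : set ('I_k.+1 -> R * R) :=
  [set z | [/\ forall i, cantor s (z i).1 /\ cantor s (z i).2,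
    nondegenerate (shear \o z) & K <= `|(z (inord 1)).1 - (z ord0).1| ] ].

Definition shear_area (z : 'I_k.+1 -> R * R) : 'rV[R]_(k.*2.-1) :=
  last_coords (normal_form (shear \o z)).

(* The index of u_i - u_1 in (1/q)Z is shifted by a constant, so that the
   subtraction in nat does not truncate. *)
Definition cells (n : nat) (z : 'I_k.+1 -> R * R) :
    {ffun 'I_k.+1 -> 'I_(2 ^ (mesh s n).+1).+1} *
    {ffun 'I_k -> 'I_((2 ^ (mesh s n).+1).+1 + 2 ^ (mesh s n).+1).+1} :=
  ([ffun i => cell s n (z i).2],
   [ffun i => inord (cell s n (z (lift ord0 i)).1
     + ((2 ^ (mesh s n).+1).+1 - cell s n (z ord0).1))]).

Lemma eq_cells_dist n z w K : cantor_params K z -> cantor_params K w ->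
  cells n z = cells n w -> forall i,
  `|(z i).2 - (w i).2| <= 2 ^- depth s n.+1 /\
  `|((z i).1 - (z ord0).1) - ((w i).1 - (w ord0).1)| <= 2 * 2 ^- depth s n.+1.
Proof.
move=> [cz _ _] [cw _ _] [/ffunP e1 /ffunP e2] i; split.
  apply: eq_cell_dist; [exact: (cz i).2|exact: (cw i).2|].
  by have := e1 i; rewrite !ffunE.
have dl0 : 0 <= (2 : R) ^- depth s n.+1 by rewrite invr_ge0 exprn_ge0.
case: (unliftP ord0 i) => [j ->|->]; last first.
  by rewrite !subrr normr0 mulr_ge0.
have /(congr1 val) := e2 j; rewrite !ffunE /= !inordK; last 2 first.
- by rewrite ltnS addnC leq_add ?leq_subr// -ltnS ltn_ord.
- by rewrite ltnS addnC leq_add ?leq_subr// -ltnS ltn_ord.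
have [z0 _] := cz ord0; have [w0 _] := cw ord0.
have [zj _] := cz (lift ord0 j); have [wj _] := cw (lift ord0 j).
have := cellP n z0; have := cellP n w0; have := cellP n zj; have := cellP n wj.
have := ltn_ord (cell s n (z ord0).1); have := ltn_ord (cell s n (w ord0).1).
move: (nat_of_ord (cell s n (z ord0).1)) (nat_of_ord (cell s n (w ord0).1)).
move: (nat_of_ord (cell s n (z (lift ord0 j)).1)).
move: (nat_of_ord (cell s n (w (lift ord0 j)).1)).
move=> b' a' b a lb la h1 h2 h3 h4 e.
have {}e : (a'%:R + a%:R = b'%:R + b%:R :> R).
  (* Cell indices stay below the shift, so its subtraction is exact and it cancels. *)
  rewrite -!natrD; congr _%:R; move: la lb e; move: (2 ^ _)%N => M; lia.
have {}e : a'%:R / 2 ^+ mesh s n + a%:R / 2 ^+ mesh s n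
    = b'%:R / 2 ^+ mesh s n + b%:R / 2 ^+ mesh s n :> R.
  by rewrite -!mulrDl e.
move: h1 h2 h3 h4 e; rewrite ler_distl.
move=> /andP[? ?] /andP[? ?] /andP[? ?] /andP[? ?] ?.
by apply/andP; split; lra.
Qed.

Lemma shear_area_dist n z w K : 0 < K ->
  cantor_params K z -> cantor_params K w -> cells n z = cells n w ->
  forall j, `|shear_area z 0 j - shear_area w 0 j|
    <= 40 * 2 ^- depth s n.+1 / K ^+ 2.
Proof.
move=> K0 Sz Sw /(eq_cells_dist Sz Sw) close j.
have [cz ndz Kz] := Sz; have [cw ndw Kw] := Sw.
set dl := 2 ^- _ in close *; have dl0 : 0 <= dl by rewrite invr_ge0 exprn_ge0.
rewrite [shear_area z 0 j]mxE [shear_area w 0 j]mxE.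
rewrite [normal_form (shear \o z) 0 _]mxE [normal_form (shear \o w) 0 _]mxE.
move: (inord _./2) (inord (odd _)) => i c /=.
have itv2 (v : 'I_k.+1 -> R * R) h :
    (forall h, cantor s (v h).1 /\ cantor s (v h).2) ->
    1 <= (v h).2 <= 2 /\ `|(v h).1 - (v ord0).1| <= 1.
  move=> cv; split; first exact: cantor_itv (cv h).2.
  have := cantor_itv (cv h).1; have := cantor_itv (cv ord0).1.
  by rewrite ler_distl => /andP[? ?] /andP[? ?]; apply/andP; split; lra.
have y1 (v : 'I_k.+1 -> R * R) :
    (forall h, cantor s (v h).1 /\ cantor s (v h).2) ->
    (v (inord 1)).2 != 0.
  by move=> cv; have [/andP[]] := itv2 v (inord 1) cv; lra.
have [ez ez0 ez1] := normalizer_shear i (y1 _ cz) ndz.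
have [ew ew0 ew1] := normalizer_shear i (y1 _ cw) ndw.
have [/andP[yi1 yi2] di] := itv2 z i cz.
have [/andP[y01 y02] _] := itv2 z ord0 cz.
have [_ e1] := itv2 z (inord 1) cz.
have [/andP[yi1' yi2'] di'] := itv2 w i cw.
have [/andP[y01' y02'] _] := itv2 w ord0 cw.
have [_ e1'] := itv2 w (inord 1) cw.
have [cyi cdi] := close i; have [cy0 _] := close ord0.
have [_ ce] := close (inord 1).
have K1 : K <= 1 by exact: le_trans Kz e1.
(* Lets the coordinate without denominator share the bound of the other one. *)
have K2 : 1 <= K ^- 2 by rewrite invf_ge1 ?exprn_gt0// exprn_ile1// ltW.
have [->|->] : c = 0 \/ c = 1.
  by case: c => [[|[|//]] ?]; [left|right]; exact: val_inj.
- rewrite ez0 ew0; move: Kz Kw di di' e1 e1' cdi ce {ez ez0 ez1 ew ew0 ew1}.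
  move: ((z i).1 - _) ((w i).1 - _) ((z _).1 - _) ((w _).1 - _) => d d' e e'.
  move: yi1 yi2 y01 y02 yi1' yi2' y01' y02' cyi cy0.
  move: (z i).2 (w i).2 (z ord0).2 (w ord0).2 => yi yi' y0 y0'.
  move=> yi1 yi2 y01 y02 yi1' yi2' y01' y02' cyi cy0.
  move=> Kz Kw di di' e1 e1' cdi ce.
  have nrm (x : R) : 1 <= x -> x <= 2 -> `|x| = x /\ `|x| <= 2.
    by move=> x1 x2; rewrite ger0_norm; lra.
  have [nyi nyi2] := nrm _ yi1 yi2; have [ny0 ny02] := nrm _ y01 y02.
  have [nyi' nyi2'] := nrm _ yi1' yi2'; have [ny0' ny02'] := nrm _ y01' y02'.
  have big (x y : R) : 1 <= x -> K <= `|y| -> K <= `|x * y|.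
    move=> x1 Ky; rewrite normrM; apply: (le_trans Ky); rewrite ler_peMl//.
    by rewrite ger0_norm; lra.
  have ed : `|e - d| <= 2.
    by apply: (le_trans (ler_normB _ _)); move: e1 di; lra.
  have ed' : `|e' - d'| <= 2.
    by apply: (le_trans (ler_normB _ _)); move: e1' di'; lra.
  have ced : `|(e - d) - (e' - d')| <= 4 * dl.
    have -> : (e - d) - (e' - d') = (e - e') - (d - d') by ring.
    by apply: (le_trans (ler_normB _ _)); move: ce cdi; lra.
  have hn := dist_prod_le nyi2' ed cyi ced.
  have hd := dist_prod_le ny02' e1 cy0 ce.
  have Kz0 := big _ _ y01 Kz; have Kw0 := big _ _ y01' Kw.
  apply: le_trans (dist_ratio_le K0 Kz0 Kw0 _ _ hn hd) _.
  + rewrite normrM; apply: (@le_trans _ _ (2 * 1)); last by lra.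
    by apply: ler_pM.
  + rewrite normrM; apply: (@le_trans _ _ (2 * 2)); last by lra.
    by apply: ler_pM.
  (* The errors are 10 [dl] in the numerator and 5 [dl] in the denominator, whence 40 = 2 * 10 + 4 *
     5. *)
  + rewrite ler_pM2r ?invr_gt0 ?exprn_gt0//; lra.
- rewrite ez1 ew1 -opprD normrN.
  have yy (x y : R) : 1 <= x <= 2 -> 1 <= y <= 2 -> `|x * y| <= 4.
    move=> /andP[? ?] /andP[? ?].
    rewrite ger0_norm; last by rewrite mulr_ge0; lra.
    by apply: (@le_trans _ _ (2 * 2)); [apply: ler_pM; lra|lra].
  have h4 : `|(w ord0).2 * (w i).2| <= 4.
    by apply: yy; rewrite ?y01' ?y02' ?yi1' ?yi2'.
  have n0' : `|(w ord0).2| <= 2 by rewrite ger0_norm; lra.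
  have ni : `|(z i).2| <= 2 by rewrite ger0_norm; lra.
  have h1 := dist_prod_le n0' ni cy0 cyi.
  apply: (le_trans (dist_prod_le h4 di h1 cdi)).
  apply: (@le_trans _ _ (40 * dl)); first by lra.
  by rewrite ler_peMr// mulr_ge0.
Qed.

(** There are at most (8q)^(2k+1) classes, from k+1 heights and k differences, each in a cube of
    side 80 q^(-2/s) / K^2 in dimension 2k-1. *)
Lemma lebesgue_vol_shear_area0 (K : R) : (1 <= k)%N ->
  s < 2 - 4 / (2 * k%:R + 1) -> 0 < K ->
  lebesgue_vol (shear_area @` cantor_params K) = 0%E.
Proof.
move=> k1 sk K0; apply/eqP; rewrite eq_le lebesgue_vol_ge0 andbT.
apply/lee_addgt0Pr => e e0; rewrite add0e.
pose a : nat := (2 * k).+1; pose b : nat := k.*2.-1.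
pose rho := 2 * b%:R / s - a%:R : R.
have bE : b%:R = 2 * k%:R - 1 :> R.
  have -> : b = (2 * k - 1)%N by rewrite /b; lia.
  by rewrite natrB ?natrM//; lia.
have aE : a%:R = 2 * k%:R + 1 :> R by rewrite /a -natr1 natrM.
have a0 : 0 < a%:R :> R by rewrite ltr0n.
(* Positivity amounts to s < 2 (2k-1) / (2k+1), and the right-hand side is 2 - 4 / (2k+1). *)
have rho0 : 0 < rho.
  rewrite subr_gt0 ltr_pdivlMr// mulrC -ltr_pdivlMr//.
  apply: (lt_le_trans sk); rewrite -aE le_eqVlt; apply/orP; left; apply/eqP.
  by rewrite bE; move: aE a0 => -> a0; field; rewrite gt_eqF.
have [X HX] := powR2N_small (8 ^+ a * (80 / K ^+ 2) ^+ b) e0.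
have [n nX] : exists n, X <= rho * (mesh s n)%:R.
  exists (Num.truncn (X / rho)).+1; rewrite mulrC -ler_pdivrMr//.
  rewrite (le_trans (ltW (truncnS_gt _)))// ler_nat.
  exact: ltnW (ltn_mesh s _).
have p0 m : 0 <= (2 : R) ^+ m by rewrite exprn_ge0.
apply: le_trans (@lebesgue_vol_classes R _ _ _ _ (cells n) shear_area
  (40 * 2 ^- depth s n.+1 / K ^+ 2) _ _) _.
- by rewrite divr_ge0 ?exprn_ge0 ?mulr_ge0 ?invr_ge0// ltW.
- by move=> z w Sz Sw; exact: (shear_area_dist K0 Sz Sw).
rewrite lee_fin card_prod !card_ffun !card_ord natrM !natrX.
have cM := card_cell_le s n.
set M := (2 ^ (mesh s n).+1).+1 in cM *.
have c2M : (M + 2 ^ (mesh s n).+1).+1%:R <= 8 * 2 ^+ mesh s n :> R.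
  rewrite -addnS natrD -/M; move: cM; lra.
apply: (@le_trans _ _ ((8 * 2 ^+ mesh s n) ^+ a *
    (2 * (40 * 2 ^- depth s n.+1 / K ^+ 2)) ^+ b)).
  rewrite ler_wpM2r//.
    rewrite exprn_ge0// mulr_ge0//.
    by rewrite divr_ge0 ?exprn_ge0 ?mulr_ge0 ?invr_ge0// ltW.
  have -> : a = (k.+1 + k)%N by rewrite /a; lia.
  have leX (x : R) p : 0 <= x -> x <= 8 * 2 ^+ mesh s n ->
      x ^+ p <= (8 * 2 ^+ mesh s n) ^+ p.
    by move=> x0 hx; rewrite lerXn2r// nnegrE mulr_ge0.
  rewrite exprD; apply: ler_pM; rewrite ?exprn_ge0// leX//.
  by apply: (le_trans cM); rewrite ler_wpM2r// ler_nat.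
apply: le_trans (HX _ nX).
have -> : 2 * (40 * 2 ^- depth s n.+1 / K ^+ 2)
    = 80 / K ^+ 2 * 2 ^- depth s n.+1 :> R by ring.
rewrite [(8 * _) ^+ a]exprMn [(_ * 2 ^- _) ^+ b]exprMn mulrACA.
have := @pow2_mesh_depth R s s0 a%:R b%:R n (ler0n _ _).
rewrite !powR_mulrn ?invr_ge0// -/rho.
have c0 : 0 <= 8 ^+ a * (80 / K ^+ 2) ^+ b :> R.
  by rewrite mulr_ge0 ?exprn_ge0 ?divr_ge0 ?exprn_ge0// ltW.
exact: ler_wpM2l c0 _ _.
Qed.

(** Non-degeneracy forces u_1 != u_2, so the configurations are exhausted by the countably many
    bounds K = 1/(N+1). *)
Lemma flat_vol_cantor_shear : (1 <= k)%N -> s < 2 - 4 / (2 * k%:R + 1) ->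
  flat_vol (area_types k (cantor_shear s)) = 0%E.
Proof.
move=> k1 sk; apply/eqP; rewrite eq_le lebesgue_vol_ge0 andbT.
have A0 (N : nat) :
    lebesgue_vol (shear_area @` cantor_params (N.+1%:R^-1)) = 0%E.
  by apply: lebesgue_vol_shear_area0; rewrite ?invr_gt0.
rewrite -(lebesgue_vol_bigcup0 A0).
apply: lebesgue_vol_le => _ [_ [[x [Ex ndx] <-] _] <-].
have /choice[z Hz] i : exists p : R * R,
    (cantor s p.1 /\ cantor s p.2) /\ shear p = x i.
  by have [p [p1 p2] pE] := Ex i; exists p.
have xz : x = shear \o z by apply/funext => i /=; rewrite (Hz i).2.
rewrite {}xz in ndx *.
have z1 : (z (inord 1)).2 != 0.
  have := cantor_itv (Hz (inord 1)).1.2; by case/andP; lra.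
have [d0 _ _] := normalizer_shear ord0 z1 ndx.
exists (Num.truncn `|(z (inord 1)).1 - (z ord0).1|^-1) => //.
exists z => //; split => //; first by move=> i; exact: (Hz i).1.
rewrite -[leRHS]invrK lef_pV2 ?posrE ?invr_gt0 ?normr_gt0// ltW//.
exact: truncnS_gt.
Qed.

End Shears.
End AreaTypesOfShears.

Theorem theorem2 (R : realType) (k : nat) (s : R)
    (hk : (1 <= k)%N) (hs0 : 0 <= s) (hs : s < 2 - 4 / (2 * k%:R + 1)) :
  exists E : set 'cV[R]_2,
    [/\ compact E, hausdorff_dim E = s%:E & flat_vol (area_types k E) = 0%E].
Proof.
have s2 : s < 2.
  by apply: (lt_le_trans hs); rewrite gerBl divr_ge0// addr_ge0// mulr_ge0.
(* The scales involve 2/s, so s = 0 is treated apart, with the empty set. *)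
move: hs0; rewrite le_eqVlt => /predU1P[<-|s0]; last first.
  exists (cantor_shear s); split; first exact: cantor_shear_compact.
    exact: hausdorff_dim_cantor_shear.
  exact: flat_vol_cantor_shear.
exists set0; split; first exact: compact0.
- apply/eqP; rewrite eq_le; apply/andP; split; last first.
    by apply: le_ereal_inf_tmp => _ [t [t0 _] <-]; rewrite lee_fin.
  apply: ereal_inf_lbound; exists 0 => //; split => //.
  apply/eqP; rewrite eq_le hausdorff_measure_ge0 andbT.
  apply: ge_ereal_sup => _ [d /= d0 <-]; apply: ereal_inf_lbound.
  by exists (set0, fun=> set0); rewrite ?esum_set0//; split.
- apply/eqP; rewrite eq_le lebesgue_vol_ge0 andbT.
  apply: ereal_inf_lbound; exists (set0, fun=> (0, 0)); rewrite ?esum_set0//.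
  split=> [i j|v [w [[x [Ex _] _] _] _]]; last by case: (Ex ord0).
  exact: lexx.
Qed.
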